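(* Let $\gamma\in(1,2]$, $\mathbf U=(D,\mathbf m,E)^\top\in\mathcal G$, and $\epsilon_1,\epsilon_2\in(0,1)$. The hybrid NR method, which uses the NR-I method if $\gamma\ge 1+\epsilon_1$ and $\frac{D^2}{E^2-|\mathbf m|^2}\ge\epsilon_2$, and uses the NR-II method otherwise, is PCP (all iterates $p_n$, $n\ge1$, are positive) and convergent ($\lim_{n\to\infty}p_n=p(\mathbf U)$), with quadratic convergence rate.
   Context: Let $d\ge 1$, $\gamma\in(1,2]$, and $\mathcal G=\{(D,\mathbf m,E)^\top: D\in\mathbb R,\ \mathbf m\in\mathbb R^d,\ E\in\mathbb R,\ D>0,\ E-\sqrt{D^2+|\mathbf m|^2}>0\}$. For $\mathbf U\in\mathcal G$ there is a unique triple $(\rho,\mathbf v,p)$ with $\rho>0$, $p>0$, $|\mathbf v|<1$ such that $D=\rho W$, $\mathbf m=DhW\mathbf v$, $E=DhW-p$, where $W=1/\sqrt{1-|\mathbf v|^2}$, $h=1+e+p/\rho$, $e=\frac{p}{(\gamma-1)\rho}$. The physical pressure $p(\mathbf U)$ is the component $p$ of this triple; it is the unique positive solution of $$\Phi(p):=\frac{p}{\gamma-1}-E+\frac{|\mathbf m|^2}{E+p}+D\sqrt{1-\frac{|\mathbf m|^2}{(E+p)^2}}=0 .$$ NR-I method: $p_{n+1}=p_n-\phi(p_n)/\phi'(p_n)$, with $p_0=0$ if $c_2>0$ and $p_0=\frac{-3c_3+\sqrt{9c_3^2-24c_2}}{12}$ otherwise, where $$\phi(p)=(\gamma-1)^2\Big[\big(|\mathbf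 m|^2+(E+p)(\tfrac{p}{\gamma-1}-E)\big)^2-D^2\big((E+p)^2-|\mathbf m|^2\big)\Big]=c_0+c_1p+c_2p^2+c_3p^3+p^4,$$ with $c_0=(|\mathbf m|^2-E^2)(|\mathbf m|^2-E^2+D^2)(\gamma-1)^2$, $c_1=2E(2-\gamma)(|\mathbf m|^2-E^2)(\gamma-1)-2ED^2(\gamma-1)^2$, $c_2=E^2(\gamma^2-6\gamma+6)+2|\mathbf m|^2(\gamma-1)-D^2(\gamma-1)^2$, $c_3=2E(2-\gamma)$. NR-II method: $p_{n+1}=p_n-\psi(p_n)/\psi'(p_n)$, with $p_0=0$ if $D\ge\frac{E^2-|\mathbf m|^2}{E}$ and $p_0=p_c^u$ otherwise, where $$\psi(p)=(E+p)\Phi(p)=|\mathbf m|^2+(E+p)\Big(\frac{p}{\gamma-1}-E\Big)+D\sqrt{(E+p)^2-|\mathbf m|^2},$$ $$p_c^u=\frac{(\gamma-2)E+\sqrt{(2-\gamma)^2E^2-4(\gamma-1)\big[(|\mathbf m|^2-E^2)+D\sqrt{E^2-|\mathbf m|^2}\big]}}{2}.$$ Quadratic convergence is meant in the standard sense (order at least $2$): $p_n\to p(\mathbf U)$ and there is a constant $C$ with $|p_{n+1}-p(\mathbf U)|\le C|p_n-p(\mathbf U)|^2$ for all sufficiently large $n$. *)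

(* Defs.v *)
From HB Require Import structures.
From mathcomp Require Import all_boot all_order all_algebra.
From mathcomp Require Import all_classical all_reals all_analysis.
From mathcomp Require Import ring.

Set Implicit Arguments.
Unset Strict Implicit.
Unset Printing Implicit Defensive.

Import Order.TTheory GRing.Theory Num.Theory.
Import numFieldNormedType.Exports.

Local Open Scope classical_set_scope.
Local Open Scope ring_scope.

(* Euclidean norm; the library norm `|v| on matrices is the sup norm. *)
Definition enorm (R : realType) (d : nat) (v : 'rV[R]_d) : R :=
  Num.sqrt (\sum_(i < d) v ord0 i ^+ 2).

(* The conservative vector U = (D, m, E). *)
Record conserved (R : realType) (d : nat) : Type :=
  Conserved { dens : R; mom : 'rV[R]_d; ener : R }.

Section RHD.
Context {R : realType} {d : nat}.
Implicit Types (gamma p rho : R) (v : 'rV[R]_d) (U : conserved R d).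

Definition admissible : set (conserved R d) :=
  [set U | 0 < dens U /\
           0 < ener U - Num.sqrt (dens U ^+ 2 + enorm (mom U) ^+ 2)].

Definition lorentz v : R := (Num.sqrt (1 - enorm v ^+ 2))^-1.

Definition internal_energy gamma rho p : R := p / ((gamma - 1) * rho).

Definition enthalpy gamma rho p : R :=
  1 + internal_energy gamma rho p + p / rho.

Definition is_primitive gamma U rho v p : Prop :=
  [/\ 0 < rho, 0 < p & enorm v < 1] /\
  [/\ dens U = rho * lorentz v,
      mom U = (dens U * enthalpy gamma rho p * lorentz v) *: v
    & ener U = dens U * enthalpy gamma rho p * lorentz v - p].

(* The default value 0 is taken only if U has no primitive triple. *)
Definition pressure gamma U : R :=
  xget 0 [set p | exists rho v, is_primitive gamma U rho v p].

Definition Phi gamma U p : R :=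
  let D := dens U in let m := enorm (mom U) in let E := ener U in
  p / (gamma - 1) - E + m ^+ 2 / (E + p)
  + D * Num.sqrt (1 - m ^+ 2 / (E + p) ^+ 2).

Definition phi gamma U p : R :=
  let D := dens U in let m := enorm (mom U) in let E := ener U in
  (gamma - 1) ^+ 2 *
  ((m ^+ 2 + (E + p) * (p / (gamma - 1) - E)) ^+ 2
   - D ^+ 2 * ((E + p) ^+ 2 - m ^+ 2)).

Definition psi gamma U p : R :=
  let D := dens U in let m := enorm (mom U) in let E := ener U in
  m ^+ 2 + (E + p) * (p / (gamma - 1) - E)
  + D * Num.sqrt ((E + p) ^+ 2 - m ^+ 2).

Definition c0 gamma U : R :=
  let D := dens U in let m := enorm (mom U) in let E := ener U in
  (m ^+ 2 - E ^+ 2) * (m ^+ 2 - E ^+ 2 + D ^+ 2) * (gamma - 1) ^+ 2.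

Definition c1 gamma U : R :=
  let D := dens U in let m := enorm (mom U) in let E := ener U in
  2 * E * (2 - gamma) * (m ^+ 2 - E ^+ 2) * (gamma - 1)
  - 2 * E * D ^+ 2 * (gamma - 1) ^+ 2.

Definition c2 gamma U : R :=
  let D := dens U in let m := enorm (mom U) in let E := ener U in
  E ^+ 2 * (gamma ^+ 2 - 6 * gamma + 6) + 2 * m ^+ 2 * (gamma - 1)
  - D ^+ 2 * (gamma - 1) ^+ 2.

Definition c3 gamma U : R := 2 * ener U * (2 - gamma).

Lemma phi_expand gamma U p : gamma != 1 ->
  phi gamma U p =
  c0 gamma U + c1 gamma U * p + c2 gamma U * p ^+ 2 + c3 gamma U * p ^+ 3
  + p ^+ 4.
Proof.
move=> g1; have g0 : gamma - 1 != 0 by rewrite subr_eq0.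
by rewrite /phi /c0 /c1 /c2 /c3 /=; field.
Qed.

Lemma psi_Phi gamma U p : 0 < ener U + p ->
  psi gamma U p = (ener U + p) * Phi gamma U p.
Proof.
move=> Ep; have Ep0 : ener U + p != 0 by rewrite gt_eqF.
rewrite /psi /Phi /=; set m := enorm _.
have -> : (ener U + p) ^+ 2 - m ^+ 2 =
    (ener U + p) ^+ 2 * (1 - m ^+ 2 / (ener U + p) ^+ 2) by field.
rewrite sqrtrM ?sqr_ge0// sqrtr_sqr gtr0_norm//.
set s := Num.sqrt _; set q := p / _.
by field.
Qed.

Definition p0_NR1 gamma U : R :=
  if 0 < c2 gamma U then 0
  else (- 3 * c3 gamma U
        + Num.sqrt (9 * c3 gamma U ^+ 2 - 24 * c2 gamma U)) / 12.

Definition p_cu gamma U : R :=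
  let D := dens U in let m := enorm (mom U) in let E := ener U in
  ((gamma - 2) * E
   + Num.sqrt ((2 - gamma) ^+ 2 * E ^+ 2
               - 4 * (gamma - 1) *
                 ((m ^+ 2 - E ^+ 2) + D * Num.sqrt (E ^+ 2 - m ^+ 2)))) / 2.

Definition p0_NR2 gamma U : R :=
  if (ener U ^+ 2 - enorm (mom U) ^+ 2) / ener U <= dens U then 0
  else p_cu gamma U.

Definition use_NR1 gamma (eps1 eps2 : R) U : bool :=
  (1 + eps1 <= gamma) &&
  (eps2 <= dens U ^+ 2 / (ener U ^+ 2 - enorm (mom U) ^+ 2)).

Definition hybrid_fun gamma (eps1 eps2 : R) U : R -> R :=
  if use_NR1 gamma eps1 eps2 U then phi gamma U else psi gamma U.

Definition hybrid_p0 gamma (eps1 eps2 : R) U : R :=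
  if use_NR1 gamma eps1 eps2 U then p0_NR1 gamma U else p0_NR2 gamma U.

End RHD.

Section Newton.
Context {R : realType}.

Definition newton (f : R -> R) (p0 : R) (n : nat) : R :=
  iter n (fun p => p - f p / f^`()%classic p) p0.

(* Division and f^`() are total, so a step is a genuine Newton step only where
   f is derivable with nonzero derivative. *)
Definition newton_well_defined (f : R -> R) (p0 : R) : Prop :=
  forall n, derivable f (newton f p0 n) 1 /\
            f^`()%classic (newton f p0 n) != 0.

Definition quadratic_convergence (u : R^nat) (l : R) : Prop :=
  u @ \oo --> l /\
  exists C : R, \forall n \near \oo, `|u n.+1 - l| <= C * `|u n - l| ^+ 2.

End Newton.

Definition hybrid_NR (R : realType) (d : nat) (gamma eps1 eps2 : R)
    (U : conserved R d) : R^nat :=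
  newton (hybrid_fun gamma eps1 eps2 U) (hybrid_p0 gamma eps1 eps2 U).

(* Main.v *)
Require Import Defs.
From HB Require Import structures.
From mathcomp Require Import all_boot all_order all_algebra.
From mathcomp Require Import all_classical all_reals all_analysis.
From mathcomp Require Import ring lra.

Set Implicit Arguments.
Unset Strict Implicit.
Unset Printing Implicit Defensive.

Import Order.TTheory GRing.Theory Num.Theory.
Import numFieldNormedType.Exports.

Local Open Scope classical_set_scope.
Local Open Scope ring_scope.

(* A Newton step for f sends x to the point at signed distance
   r(x) (x - l)^2 / f'(x) from a simple root l, where r(x) (x - l)^2 is the
   second order Taylor remainder of f at x, evaluated at l.  So the sign of
   r / f' decides on which side of l the iterates land.  For psi the derivative
   is at least D and r increases with x: if r(l) >= 0 no step crosses l from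
   above, if r(l) <= 0 no step crosses l from below.  Either way the sequence
   eventually stays on one side of l, and there each step contracts the distance
   to l.  For phi, a quartic, the start is 0 or the inflection point; between
   the start and l the function is decreasing and either convex or concave, so
   the iterates run monotonically to l. *)

(** * A convergence criterion for Newton's method *)

Lemma cvg_dist_contract (R : realType) (u : R^nat) (l k : R) (n0 : nat) :
  0 < k <= 1 ->
  (forall n, (n0 <= n)%N -> `|u n.+1 - l| <= (1 - k) * `|u n - l|) ->
  u @ \oo --> l.
Proof.
move=> /andP[k0 k1] hk.
have le_geo n : `|u (n + n0)%N - l| <= geometric `|u n0 - l| (1 - k) n.
  elim: n => [|n IHn] /=; first by rewrite add0n expr0 mulr1.
  rewrite addSn exprS mulrCA (le_trans (hk _ (leq_addl _ _)))//.
  by rewrite ler_wpM2l ?subr_ge0.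
rewrite -(cvg_shiftn n0); apply/subr_cvg0/norm_cvg0P.
apply: (@squeeze_cvgr _ _ _ _ (fun=> 0) (geometric `|u n0 - l| (1 - k))).
- by near=> n; rewrite normr_ge0 le_geo.
- exact: cvg_cst.
- by apply: cvg_geometric; rewrite ger0_norm ?subr_ge0// ltrBlDr ltrDl.
Unshelve. all: by end_near. Qed.

(** The set [P] is a region that the iteration never leaves. Steps are barred from crossing [l] in
    one direction only, so the sequence changes sides at most once; from then on the lower bound on
    the step length gives a contraction with factor [1 - k]. The constant [k] may depend on a bound
    [B] for the distance to [l], because the derivative of [psi] is unbounded. *)
Lemma newton_cvg (R : realType) (f df : R -> R) (P : R -> Prop) (l p0 C : R)
    (N := fun x => x - f x / df x) :
  (forall x, P x -> is_derive x 1 f (df x)) ->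
  (forall x, P x -> df x != 0) ->
  P p0 ->
  (forall x, P x -> P (N x)) ->
  (forall x, P x -> x <= l -> N x <= l) \/
    (forall x, P x -> l <= x -> l <= N x) ->
  (forall B, exists2 k, 0 < k <= 1 & forall x, P x -> `|x - l| <= B ->
     (x <= l -> k * (l - x) <= N x - x) /\
     (l <= x -> k * (x - l) <= x - N x)) ->
  (forall x, P x -> `|N x - l| <= C * `|x - l| ^+ 2) ->
  [/\ newton_well_defined f p0,
      forall n, P (newton f p0 n) /\ newton f p0 n.+1 = N (newton f p0 n)
    & quadratic_convergence (newton f p0) l].
Proof.
move=> df_f df0 Pp0 PN side toward quad.
have dfE x : P x -> f^`()%classic x = df x.
  by move=> Px; rewrite derive1E; apply: derive_val; exact: df_f.
have step x : P x -> x - f x / f^`()%classic x = N x by move=> Px; rewrite dfE.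
have Pn n : P (newton f p0 n).
  by elim: n => // n IHn; rewrite /newton iterS step//; exact: PN.
have SnE n : newton f p0 n.+1 = N (newton f p0 n).
  by rewrite {1}/newton iterS step//; exact: Pn.
(* If steps from one side of [l] stay there, either some iterate reaches that side and all later
   ones remain, or every iterate lies on the other side. *)
have [n0 one_side] : exists n0,
    (forall n, (n0 <= n)%N -> newton f p0 n <= l) \/
    (forall n, (n0 <= n)%N -> l <= newton f p0 n).
  case: side => hs.
    have [[n0 n0l]|/forallNP gtl] := pselect (exists n, newton f p0 n <= l).
      exists n0; left; elim=> [|n IHn]; first by rewrite leqn0 => /eqP <-.
      rewrite leq_eqVlt => /orP[/eqP <-//|]; rewrite ltnS => /IHn nl.
      by rewrite SnE; apply: hs.
    by exists 0; right => n _; rewrite ltW// ltNge; apply/negP/gtl.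
  have [[n0 n0l]|/forallNP ltl] := pselect (exists n, l <= newton f p0 n).
    exists n0; right; elim=> [|n IHn]; first by rewrite leqn0 => /eqP <-.
    rewrite leq_eqVlt => /orP[/eqP <-//|]; rewrite ltnS => /IHn nl.
    by rewrite SnE; apply: hs.
  by exists 0; left => n _; rewrite ltW// ltNge; apply/negP/ltl.
(* The distance to [l] does not increase after [n0], so the [k] obtained for the distance at [n0]
   serves every later step. *)
have [k /andP[k0 k1] hk] := toward `|newton f p0 n0 - l|.
have contr n : (n0 <= n)%N -> `|newton f p0 n - l| <= `|newton f p0 n0 - l| ->
    `|newton f p0 n.+1 - l| <= (1 - k) * `|newton f p0 n - l|.
  move=> n0n /(hk _ (Pn n))[]; rewrite -SnE.
  case: one_side => hs.
    have := hs n n0n; have := hs n.+1 (leqW n0n) => ha hb.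
    by move=> /(_ hb) + _; rewrite !ler0_norm ?subr_le0// => ?; lra.
  have := hs n n0n; have := hs n.+1 (leqW n0n) => ha hb.
  by move=> _ /(_ hb); rewrite !ger0_norm ?subr_ge0// => ?; lra.
have bound n : (n0 <= n)%N ->
    `|newton f p0 n - l| <= `|newton f p0 n0 - l|.
  elim: n => [|n IHn]; first by rewrite leqn0 => /eqP <-.
  rewrite leq_eqVlt => /orP[/eqP <-//|]; rewrite ltnS => n0n.
  rewrite (le_trans (contr _ n0n (IHn n0n)))// (le_trans _ (IHn n0n))//.
  by rewrite ler_piMl// gerBl ltW.
split=> //.
- move=> n; rewrite dfE; last exact: Pn.
  by split; [by case: (df_f _ (Pn n)) | exact/df0/Pn].
- split.
    apply: (@cvg_dist_contract _ _ _ k n0); first by rewrite k0.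
    by move=> n n0n; apply: contr => //; exact: bound.
  by exists C; near=> n; rewrite SnE; apply: quad; exact: Pn.
Unshelve. all: by end_near. Qed.

(** The [0] on the left of the Taylor formula is the value of the function at its root [l]; solving
    the formula for [fx] gives the claim. *)
Lemma newton_step_dist (F : fieldType) (x l fx dfx r : F) : dfx != 0 ->
  0 = fx + dfx * (l - x) + r * (l - x) ^+ 2 ->
  x - fx / dfx - l = r * (x - l) ^+ 2 / dfx.
Proof.
move=> d0 h; have -> : fx = - (dfx * (l - x)) - r * (l - x) ^+ 2.
  by apply/eqP; rewrite -subr_eq0 opprD !opprK addrA -h.
by field.
Qed.

(** * Newton's method for a quartic, started at 0 or at an inflection point *)

Section QuarticNewton.
Context {R : realType} (c0 c1 c2 c3 : R).
Implicit Types p q l s : R.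

Definition quartic p : R := c0 + c1 * p + c2 * p ^+ 2 + c3 * p ^+ 3 + p ^+ 4.

Definition quartic_der p : R :=
  c1 + 2 * c2 * p + 3 * c3 * p ^+ 2 + 4 * p ^+ 3.

Definition quartic_rem p q : R :=
  c2 + c3 * (2 * p + q) + 3 * p ^+ 2 + 2 * (p * q) + q ^+ 2.

Lemma quartic_taylor p q :
  quartic q =
  quartic p + quartic_der p * (q - p) + quartic_rem p q * (q - p) ^+ 2.
Proof. by rewrite /quartic /quartic_der /quartic_rem; ring. Qed.

Lemma is_derive_quartic (p : R) : is_derive p 1 quartic (quartic_der p).
Proof.
rewrite /quartic; apply: is_derive_eq; rewrite /GRing.scale /=.
by rewrite /quartic_der; ring.
Qed.

(** Half the second derivative of the quartic. *)
Definition quartic_curv p : R := c2 + 3 * c3 * p + 6 * p ^+ 2.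

Definition quartic_der_slope p q : R :=
  2 * c2 + 3 * c3 * (p + q) + 4 * (p ^+ 2 + p * q + q ^+ 2).

Lemma quartic_der_sub p q :
  quartic_der q - quartic_der p = (q - p) * quartic_der_slope p q.
Proof. by rewrite /quartic_der /quartic_der_slope; ring. Qed.

(** Put [p = s + a] and [q = s + b]: both quantities become a positive multiple of [quartic_curv s]
    plus a polynomial in [a], [b], [s], [c3] with nonnegative coefficients. *)
Lemma quartic_convex s p q : 0 <= c3 -> 0 <= s -> 0 <= quartic_curv s ->
  s <= p -> s <= q -> 0 <= quartic_der_slope p q /\ 0 <= quartic_rem p q.
Proof.
move=> c3_ge0 s0 cs sp sq.
have [a0 b0] : 0 <= p - s /\ 0 <= q - s by rewrite !subr_ge0.
rewrite -(subrK s p) -(subrK s q).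
set a := p - s in a0 *; set b := q - s in b0 *.
have := mulr_ge0 c3_ge0 a0; have := mulr_ge0 c3_ge0 b0.
have := mulr_ge0 s0 a0; have := mulr_ge0 s0 b0; have := mulr_ge0 a0 b0.
have := sqr_ge0 a; have := sqr_ge0 b; move: cs.
by rewrite /quartic_curv /quartic_der_slope /quartic_rem; split; lra.
Qed.

Lemma quartic_concave s p q : 0 <= c3 -> quartic_curv s <= 0 ->
  0 <= p <= s -> 0 <= q <= s ->
  quartic_der_slope p q <= 0 /\ quartic_rem p q <= 0.
Proof.
move=> c3_ge0 cs /andP[p0 ps] /andP[q0 qs].
have [a0 b0] : 0 <= s - p /\ 0 <= s - q by rewrite !subr_ge0.
have s0 : 0 <= s by exact: le_trans ps.
have := mulr_ge0 c3_ge0 a0; have := mulr_ge0 c3_ge0 b0.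
have := mulr_ge0 s0 a0; have := mulr_ge0 s0 b0.
have := mulr_ge0 p0 a0; have := mulr_ge0 q0 b0.
have := mulr_ge0 p0 b0; have := mulr_ge0 q0 a0; move: cs.
by rewrite /quartic_curv /quartic_der_slope /quartic_rem; split; lra.
Qed.

Lemma quartic_rem_bound p q s : 0 <= p <= s -> 0 <= q <= s ->
  `|quartic_rem p q| <= `|c2| + 3 * `|c3| * s + 6 * s ^+ 2.
Proof.
move=> /andP[p0 ps] /andP[q0 qs]; have s0 : 0 <= s by exact: le_trans ps.
have [a0 b0] : 0 <= s - p /\ 0 <= s - q by rewrite !subr_ge0.
have -> : quartic_rem p q =
    c2 + c3 * (2 * p + q) + (3 * p ^+ 2 + 2 * (p * q) + q ^+ 2).
  by rewrite /quartic_rem; ring.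
apply: le_trans (ler_normD _ _) _; apply: lerD.
  apply: le_trans (ler_normD _ _) _; rewrite lerD2l normrM [3 * _]mulrC -mulrA.
  by rewrite ler_wpM2l// ger0_norm; lra.
have := mulr_ge0 s0 a0; have := mulr_ge0 s0 b0.
have := mulr_ge0 p0 a0; have := mulr_ge0 q0 b0.
have := mulr_ge0 p0 b0; have := mulr_ge0 q0 a0.
have := mulr_ge0 p0 q0; have := sqr_ge0 p; have := sqr_ge0 q.
by move=> *; rewrite ger0_norm; lra.
Qed.

(* The quartic is convex between [s] and [l] if [s <= l], concave if
   [l <= s]. *)
Lemma quartic_newton l s : 0 <= c3 -> 0 < l -> 0 <= s ->
  quartic l = 0 -> quartic_der l < 0 ->
  0 <= quartic_curv s -> s = 0 \/ quartic_curv s = 0 ->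
  [/\ newton_well_defined quartic s,
      forall n, (1 <= n)%N -> 0 < newton quartic s n
    & quadratic_convergence (newton quartic s) l].
Proof.
move=> c3_ge0 l_gt0 s0 ql dl cs s_infl; have l0 := ltW l_gt0.
pose N x := x - quartic x / quartic_der x.
(* The points between the start and the root, in either order. *)
pose P x := s <= x <= l \/ l <= x <= s.
have P_ge0 x : P x -> 0 <= x <= s + l.
  case=> /andP[h1 h2].
    by rewrite (le_trans s0 h1)/= (le_trans h2)// lerDr.
  by rewrite (le_trans l0 h1)/= (le_trans h2)// lerDl.
(* Here [s >= l > 0] rules out [s = 0], so [s] is an inflection point. *)
have below x : l <= x <= s -> 0 <= l <= s /\ 0 <= x <= s /\ quartic_curv s <= 0.
  move=> /andP[lx xs]; rewrite l0 xs (le_trans l0 lx) (le_trans lx xs)/=.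
  split=> //; split=> //; case: s_infl => [s_0|->//].
  by have := lt_le_trans l_gt0 (le_trans lx xs); rewrite s_0 ltxx.
have der_between x : P x ->
    quartic_der s <= quartic_der x /\ quartic_der x <= quartic_der l.
  case=> [/andP[sx xl]|lxs].
    split; rewrite -subr_ge0 quartic_der_sub mulr_ge0 ?subr_ge0//;
      by case: (@quartic_convex s s x); case: (@quartic_convex s x l);
        rewrite // (le_trans sx xl).
  have [ls [xs cs0]] := below x lxs; have /andP[lx xls] := lxs.
  have ss : 0 <= s <= s by rewrite s0 lexx.
  split; rewrite -subr_ge0 quartic_der_sub mulr_le0 ?subr_le0//.
    by have [] := quartic_concave c3_ge0 cs0 ss xs.
  by have [] := quartic_concave c3_ge0 cs0 xs ls.
have der_lt0 x : P x -> quartic_der x < 0.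
  by move=> /der_between[_ /le_lt_trans]; exact.
have NE x : P x -> N x - l = quartic_rem x l * (x - l) ^+ 2 / quartic_der x.
  move=> Px; apply: newton_step_dist; first by rewrite lt_eqF ?der_lt0.
  by rewrite -ql; exact: quartic_taylor.
have Ps : P s by rewrite /P lexx /= andbT; have [?|/ltW ?] := leP s l; [left|right].
have ds := der_lt0 s Ps.
(* By convexity or concavity, [quartic x] is at least [quartic_der l * (x - l)] in absolute value,
   and between [s] and [l] the derivative is largest in absolute value at [s]. Hence a step covers
   at least this fraction of the distance to [l]. *)
pose k := quartic_der l / quartic_der s.
have k_gt0 : 0 < k by rewrite /k -divrNN divr_gt0// oppr_gt0.
have k_le1 : k <= 1.
  by rewrite /k -divrNN ler_pdivrMr ?oppr_gt0// mul1r lerN2; case: (der_between s Ps).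
have kle x : P x -> k <= quartic_der l / quartic_der x.
  move=> Px; rewrite /k -divrNN -[leRHS]divrNN ler_wpM2l ?oppr_ge0 ?(ltW dl)//.
  by rewrite lef_pV2 ?posrE ?oppr_gt0 ?der_lt0// lerN2; case: (der_between x Px).
have step_up x : s <= x <= l -> k * (l - x) <= N x - x.
  move=> sxl; have Px : P x by left.
  have /andP[sx xl] := sxl.
  have [_ rem0] := quartic_convex c3_ge0 s0 cs (le_trans sx xl) sx.
  apply: (@le_trans _ _ (quartic_der l / quartic_der x * (l - x))).
    by rewrite ler_wpM2r ?subr_ge0// kle.
  rewrite /N addrAC subrr add0r mulrAC -mulNr ler_nM2r ?invr_lt0 ?der_lt0//.
  have := quartic_taylor l x; rewrite ql add0r => ->.
  by have := mulr_ge0 rem0 (sqr_ge0 (x - l)); lra.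
have step_down x : l <= x <= s -> k * (x - l) <= x - N x.
  move=> lxs; have Px : P x by right.
  have [ls [xs cs0]] := below x lxs; have /andP[lx xls] := lxs.
  have [_ rem0] := quartic_concave c3_ge0 cs0 ls xs.
  apply: (@le_trans _ _ (quartic_der l / quartic_der x * (x - l))).
    by rewrite ler_wpM2r ?subr_ge0// kle.
  rewrite /N opprB addrCA subrr addr0 mulrAC ler_nM2r ?invr_lt0 ?der_lt0//.
  have := quartic_taylor l x; rewrite ql add0r => ->.
  by have := mulr_le0_ge0 rem0 (sqr_ge0 (x - l)); lra.
have Nle x : s <= x <= l -> N x <= l.
  move=> sxl; have Px : P x by left.
  have /andP[sx xl] := sxl.
  have [_ rem0] := quartic_convex c3_ge0 s0 cs sx (le_trans sx xl).
  rewrite -subr_le0 NE// mulr_ge0_le0 ?invr_le0 ?(ltW (der_lt0 _ Px))//.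
  by rewrite mulr_ge0 ?sqr_ge0.
have Nge x : l <= x <= s -> l <= N x.
  move=> lxs; have Px : P x by right.
  have [ls [xs cs0]] := below x lxs.
  have [_ rem0] := quartic_concave c3_ge0 cs0 xs ls.
  rewrite -subr_ge0 NE// mulr_le0 ?invr_le0 ?(ltW (der_lt0 _ Px))//.
  by rewrite mulr_le0_ge0 ?sqr_ge0.
have x_le_N x : s <= x <= l -> x <= N x.
  move=> sxl; rewrite -subr_ge0; apply: le_trans (step_up x sxl).
  by rewrite mulr_ge0 ?(ltW k_gt0)// subr_ge0; case/andP: sxl.
have N_le_x x : l <= x <= s -> N x <= x.
  move=> lxs; rewrite -subr_ge0; apply: le_trans (step_down x lxs).
  by rewrite mulr_ge0 ?(ltW k_gt0)// subr_ge0; case/andP: lxs.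
have N_gt0 x : P x -> 0 < N x.
  move=> [sxl|lxs]; last exact: lt_le_trans (Nge x lxs).
  have /andP[sx xl] := sxl; have x0 := le_trans s0 sx.
  have [->|xnl] := eqVneq x l; first by rewrite /N ql mul0r subr0.
  rewrite (le_lt_trans x0)// -subr_gt0; apply: lt_le_trans (step_up x sxl).
  by rewrite mulr_gt0// subr_gt0 lt_neqAle xnl.
pose M := s + l.
have lM : 0 <= l <= M by rewrite l0 lerDr.
have [] := @newton_cvg R quartic quartic_der P l s
  ((`|c2| + 3 * `|c3| * M + 6 * M ^+ 2) / - quartic_der l).
- by move=> x _; exact: is_derive_quartic.
- by move=> x Px; rewrite lt_eqF ?der_lt0.
- exact: Ps.
- move=> x [] h; have /andP[h1 h2] := h; [left|right].
    by rewrite (le_trans h1 (x_le_N x h)) Nle.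
  by rewrite (le_trans (N_le_x x h) h2) Nge.
- have [sl|/ltW ls] := leP s l; [left|right] => x Px hx.
    apply: Nle; rewrite hx andbT.
    by case: Px => /andP[//]; move=> lx _; exact: le_trans lx.
  apply: Nge; rewrite hx /=.
  by case: Px => /andP[//]; move=> _ xl; exact: le_trans ls.
- move=> B; exists k; first by rewrite k_gt0.
  move=> x Px _; split=> hx.
    case: Px => h; first exact: step_up.
    have -> : x = l by apply/le_anti; rewrite hx; case/andP: h.
    by rewrite /N ql mul0r subr0 subrr mulr0.
  case: Px => h; last exact: step_down.
  have -> : x = l by apply/le_anti; rewrite hx; case/andP: h => _ ->.
  by rewrite /N ql mul0r subr0 subrr mulr0.
- move=> x Px; rewrite NE// normrM normfV normrM (ger0_norm (sqr_ge0 _)).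
  rewrite real_normK ?num_real// mulrAC ler_wpM2r ?sqr_ge0//.
  have dx := der_lt0 x Px; rewrite (ltr0_norm dx).
  rewrite ler_pM ?invr_ge0 ?oppr_ge0 ?(ltW dx)//.
    by apply: quartic_rem_bound => //; exact: P_ge0.
  by rewrite lef_pV2 ?posrE ?oppr_gt0// lerN2; case: (der_between x Px).
move=> wd it quad; split=> // -[//|n] _.
by have [Pn ->] := it n; exact: N_gt0.
Qed.

End QuarticNewton.

(** * The square root in [psi]: monotonicity and concavity *)

Section PsiNewton.
Context {R : realType} (D m E : R).
Context (D_gt0 : 0 < D) (E_gt0 : 0 < E) (DmE : D ^+ 2 + m ^+ 2 < E ^+ 2).

Implicit Types p q r l : R.

Definition wroot p : R := Num.sqrt ((E + p) ^+ 2 - m ^+ 2).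

Local Ltac wlra := move: D_gt0 E_gt0 DmE; lra.
Local Ltac wnra := move: D_gt0 E_gt0 DmE; nra.

Lemma radicand_gt0 p : 0 <= p -> 0 < (E + p) ^+ 2 - m ^+ 2.
Proof.
move=> p0; have := mulr_ge0 (ltW E_gt0) p0.
by have := sqr_ge0 p; have := sqr_ge0 D; wlra.
Qed.

Lemma wroot_gt0 p : 0 <= p -> 0 < wroot p.
Proof. by move=> p0; rewrite sqrtr_gt0 radicand_gt0. Qed.

Lemma wroot_sqr p : 0 <= p -> wroot p ^+ 2 = (E + p) ^+ 2 - m ^+ 2.
Proof. by move=> p0; rewrite sqr_sqrtr// ltW// radicand_gt0. Qed.

Lemma wroot_le p q : 0 <= p -> p <= q -> wroot p <= wroot q.
Proof.
move=> p0 pq; rewrite ler_sqrt; last by rewrite ltW// radicand_gt0//; wlra.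
by rewrite lerD2r ler_sqr ?nnegrE; wlra.
Qed.

Lemma wroot_le_add p : 0 <= p -> wroot p <= E + p.
Proof.
move=> p0; have w0 := wroot_gt0 p0; have := wroot_sqr p0.
by rewrite -ler_sqr ?nnegrE; have := sqr_ge0 m; wlra.
Qed.

(** The derivative [(E + p) / wroot p] of [wroot] is nonincreasing; after squaring, the difference
    of the two sides factors. *)
Lemma wroot_ratio_le p q : 0 <= p -> p <= q ->
  (E + q) * wroot p <= (E + p) * wroot q.
Proof.
move=> p0 pq; have q0 : 0 <= q by wlra.
have wp := wroot_gt0 p0; have wq := wroot_gt0 q0.
rewrite -ler_sqr ?nnegrE ?mulr_ge0//; try wlra.
rewrite !exprMn !wroot_sqr// -subr_ge0.
have -> : (E + p) ^+ 2 * ((E + q) ^+ 2 - m ^+ 2)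
  - (E + q) ^+ 2 * ((E + p) ^+ 2 - m ^+ 2)
  = m ^+ 2 * ((q - p) * (2 * E + p + q)) by ring.
by rewrite mulr_ge0 ?sqr_ge0// mulr_ge0//; wlra.
Qed.

(** The divided difference of [wroot], rationalized by the conjugate so that at [p = q] it is the
    derivative. *)
Definition wslope p q : R := (2 * E + p + q) / (wroot p + wroot q).

Lemma wslopeE p q : 0 <= p -> 0 <= q ->
  wroot q - wroot p = (q - p) * wslope p q.
Proof.
move=> p0 q0; have wp := wroot_gt0 p0; have wq := wroot_gt0 q0.
have s0 : wroot p + wroot q != 0 by rewrite gt_eqF// addr_gt0.
rewrite /wslope mulrA; apply/(canRL (mulfK s0)).
by have := wroot_sqr p0; have := wroot_sqr q0; wnra.
Qed.

Lemma wslope_ge1 p q : 0 <= p -> 0 <= q -> 1 <= wslope p q.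
Proof.
move=> p0 q0; have wp := wroot_gt0 p0; have wq := wroot_gt0 q0.
rewrite ler_pdivlMr ?addr_gt0// mul1r.
by have := wroot_le_add p0; have := wroot_le_add q0; wlra.
Qed.

(** This is the concavity of [wroot]. After cross-multiplication the inequality is the sum of [h1]
    and [h2]. *)
Lemma wslope_antimono p q r : 0 <= p -> p <= q -> 0 <= r ->
  wslope q r <= wslope p r.
Proof.
move=> p0 pq r0; have q0 : 0 <= q by wlra.
have wp := wroot_gt0 p0; have wq := wroot_gt0 q0; have wr := wroot_gt0 r0.
rewrite ler_pdivrMr ?addr_gt0// mulrAC ler_pdivlMr ?addr_gt0//.
have h1 := wroot_ratio_le p0 pq.
have h2 : wroot r * (q - p) <= (E + r) * (wroot q - wroot p).
  rewrite wslopeE// [leRHS]mulrCA [leLHS]mulrC ler_wpM2l//; first wlra.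
  have wE := wroot_le_add r0.
  by rewrite (le_trans wE)// ler_peMr ?wslope_ge1//; wlra.
by wnra.
Qed.

(** The slope is the mediant of the derivatives of [wroot] at [p] and [q], and both are at most the
    derivative at 0. *)
Lemma wslope_le p q : 0 <= p -> 0 <= q -> wslope p q <= E / wroot 0.
Proof.
move=> p0 q0; have wp := wroot_gt0 p0; have wq := wroot_gt0 q0.
have w0 := wroot_gt0 (lexx 0).
rewrite ler_pdivrMr ?addr_gt0// mulrAC ler_pdivlMr//.
by have := wroot_ratio_le (lexx 0) p0; have := wroot_ratio_le (lexx 0) q0; wnra.
Qed.

(** * Newton's method for [psi] *)

Context (gamma : R) (gamma_gt1 : 1 < gamma) (gamma_le2 : gamma <= 2).

Definition psi_fun p : R :=
  m ^+ 2 + (E + p) * (p / (gamma - 1) - E) + D * wroot p.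

Definition psi_der p : R :=
  (2 * p + (2 - gamma) * E) / (gamma - 1) + D * (E + p) / wroot p.

Local Ltac plra := move: D_gt0 E_gt0 DmE gamma_gt1 gamma_le2; lra.
Local Ltac pnra := move: D_gt0 E_gt0 DmE gamma_gt1 gamma_le2; nra.

Lemma psi_fun_slope p q : 0 <= p -> 0 <= q ->
  psi_fun q - psi_fun p =
  (q - p) * ((p + q + (2 - gamma) * E) / (gamma - 1) + D * wslope p q).
Proof.
move=> p0 q0; have /eqP := wslopeE p0 q0; rewrite subr_eq => /eqP.
rewrite /psi_fun => ->; have g0 : gamma - 1 != 0 by plra.
by field.
Qed.

Lemma psi_fun_expansive p q : 0 <= p -> p <= q ->
  D * (q - p) <= psi_fun q - psi_fun p.
Proof.
move=> p0 pq; have q0 : 0 <= q by plra.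
rewrite psi_fun_slope// mulrC ler_wpM2l ?subr_ge0//.
have s1 := wslope_ge1 p0 q0.
rewrite -[leLHS]add0r; apply: lerD; last by rewrite ler_peMr// ltW.
have := mulr_ge0 (_ : 0 <= 2 - gamma) (ltW E_gt0) => /(_ ltac:(plra)) gE.
by rewrite divr_ge0//; plra.
Qed.

(** The second order Taylor remainder of [psi_fun] at [p], divided by [(q - p) ^+ 2]. The second
    term comes from [wroot]; in this form it is a product of two nonnegative factors, each
    nonincreasing in [p], whence [psi_rem_mono]. *)
Definition psi_rem p q : R :=
  (gamma - 1)^-1 - D / (2 * wroot p) * (wslope p q ^+ 2 - 1).

Lemma psi_taylor p q : 0 <= p -> 0 <= q ->
  psi_fun q = psi_fun p + psi_der p * (q - p) + psi_rem p q * (q - p) ^+ 2.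
Proof.
move=> p0 q0; have wp := wroot_gt0 p0; have wn : wroot p != 0 by plra.
have g0 : gamma - 1 != 0 by plra.
have hq : wroot q = wroot p + (q - p) * wslope p q by rewrite -wslopeE// addrC subrK.
(* Obtained by squaring [hq] and inserting the values of [wroot p ^+ 2] and [wroot q ^+ 2]. *)
have hs : (q - p) ^+ 2 * wslope p q ^+ 2 =
    (q - p) * (2 * E + p + q) - 2 * wroot p * ((q - p) * wslope p q).
  have := wroot_sqr q0; rewrite hq sqrrD wroot_sqr// exprMn.
  set X := wroot p * _; set Y := _ * _ ^+ 2 => h.
  have -> : Y = (E + q) ^+ 2 - (E + p) ^+ 2 - X *+ 2 by plra.
  by rewrite /X; ring.
have -> : psi_rem p q * (q - p) ^+ 2 = (q - p) ^+ 2 / (gamma - 1)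
    - D / (2 * wroot p) * ((q - p) ^+ 2 * wslope p q ^+ 2 - (q - p) ^+ 2).
  by rewrite /psi_rem; ring.
rewrite hs /psi_fun /psi_der hq; field.
by rewrite wn.
Qed.

Lemma psi_rem_mono p q r : 0 <= p -> p <= q -> 0 <= r ->
  psi_rem p r <= psi_rem q r.
Proof.
move=> p0 pq r0; have q0 : 0 <= q by plra.
have wp := wroot_gt0 p0; have wq := wroot_gt0 q0.
rewrite lerD2l lerN2 ler_pM//.
- by rewrite divr_ge0 ?mulr_ge0// ltW.
- by have := wslope_ge1 q0 r0; pnra.
- rewrite ler_pM2l// lef_pV2 ?posrE ?mulr_gt0// ler_pM2l//.
  exact: wroot_le.
- by have := wslope_antimono p0 pq r0; have := wslope_ge1 q0 r0; pnra.
Qed.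

Lemma psi_rem_bound p q : 0 <= p -> 0 <= q ->
  `|psi_rem p q| <= (gamma - 1)^-1 + D / (2 * wroot 0) * (E / wroot 0) ^+ 2.
Proof.
move=> p0 q0; have wp := wroot_gt0 p0; have w0 := wroot_gt0 (lexx 0).
have s1 := wslope_ge1 p0 q0; have sE := wslope_le p0 q0.
have gV : 0 < (gamma - 1)^-1 by rewrite invr_gt0; plra.
rewrite (le_trans (ler_normB _ _))// (gtr0_norm gV) lerD2l.
rewrite normrM !ger0_norm ?divr_ge0 ?mulr_ge0 ?(ltW D_gt0) ?(ltW wp)//; last pnra.
rewrite ler_pM//.
- by rewrite divr_ge0 ?mulr_ge0// ltW.
- by pnra.
- rewrite ler_pM2l// lef_pV2 ?posrE ?mulr_gt0// ler_pM2l//.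
  exact: wroot_le.
- by pnra.
Qed.

Lemma psi_der_ge p : 0 <= p -> D <= psi_der p.
Proof.
move=> p0; have wp := wroot_gt0 p0.
have := mulr_ge0 (_ : 0 <= 2 - gamma) (ltW E_gt0) => /(_ ltac:(plra)) gE.
rewrite -[leLHS]add0r; apply: lerD; first by rewrite divr_ge0//; plra.
by rewrite -mulrA ler_peMr ?(ltW D_gt0)// ler_pdivlMr// mul1r wroot_le_add.
Qed.

Lemma psi_der_le p B : 0 <= p -> p <= B ->
  psi_der p <= (2 * B + (2 - gamma) * E) / (gamma - 1) + D * E / wroot 0.
Proof.
move=> p0 pB; have wp := wroot_gt0 p0; have w0 := wroot_gt0 (lexx 0).
apply: lerD.
  by rewrite ler_pM2r ?invr_gt0//; plra.
rewrite -!mulrA ler_pM2l// ler_pdivrMr// mulrAC ler_pdivlMr//.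
by have := wroot_ratio_le (lexx 0) p0; pnra.
Qed.

Lemma is_derive_psi (p : R) : 0 <= p -> is_derive p 1 psi_fun (psi_der p).
Proof.
move=> p0; have rp := radicand_gt0 p0; have wp := wroot_gt0 p0.
have dr : is_derive p 1 (fun x : R => (E + x) ^+ 2 - m ^+ 2) (2 * (E + p)).
  apply: is_derive_eq; rewrite /GRing.scale /=.
  by ring.
have dw : is_derive p 1 wroot ((2 * wroot p)^-1 * (2 * (E + p))).
  apply: (@is_derive1_comp _ Num.sqrt (fun x : R => (E + x) ^+ 2 - m ^+ 2)).
  exact: is_derive1_sqrt.
rewrite /psi_fun; apply: is_derive_eq; rewrite /GRing.scale /=.
have wn : wroot p != 0 by plra.
have g0 : gamma - 1 != 0 by plra.
by rewrite /psi_der; field; rewrite wn.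
Qed.

(* The tangent at [p] meets the axis of ordinates below the origin, so that the
   Newton iterate stays positive. *)
Lemma psi_tangent_neg p : 0 < p -> D <= (E ^+ 2 - m ^+ 2) / E ->
  psi_fun p < p * psi_der p.
Proof.
move=> p_gt0; have p0 := ltW p_gt0; rewrite ler_pdivlMr// => DK.
have wp := wroot_gt0 p0; have wn : wroot p != 0 by plra.
have g0 : gamma - 1 != 0 by plra.
have -> : psi_fun p = m ^+ 2 + (E + p) * (p / (gamma - 1) - E)
    + D * ((E + p) ^+ 2 - m ^+ 2) / wroot p.
  by rewrite -wroot_sqr// /psi_fun; field; rewrite wn.
rewrite -subr_gt0.
have -> : p * psi_der p - (m ^+ 2 + (E + p) * (p / (gamma - 1) - E)
    + D * ((E + p) ^+ 2 - m ^+ 2) / wroot p)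
  = p ^+ 2 / (gamma - 1) + (E ^+ 2 - m ^+ 2 -
      D * (E ^+ 2 - m ^+ 2 + p * E) / wroot p).
  by rewrite /psi_der; field; rewrite wn.
(* With [K = E ^+ 2 - m ^+ 2] this yields [D * (K + p * E) / wroot p <= D * E <= K], so the bracket
   is nonnegative and the term [p ^+ 2 / (gamma - 1)] makes the sum positive. *)
have KEw : E ^+ 2 - m ^+ 2 + p * E <= E * wroot p.
  have pE := mulr_ge0 p0 (ltW E_gt0); have m2 := sqr_ge0 m; have D2 := sqr_ge0 D.
  rewrite -ler_sqr ?nnegrE ?mulr_ge0//; [|plra|plra|plra].
  rewrite exprMn wroot_sqr// -subr_ge0.
  have -> : E ^+ 2 * ((E + p) ^+ 2 - m ^+ 2) - (E ^+ 2 - m ^+ 2 + p * E) ^+ 2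
    = m ^+ 2 * (E ^+ 2 - m ^+ 2 + 2 * (p * E)) by ring.
  by rewrite mulr_ge0//; plra.
rewrite ltr_wpDr ?divr_gt0 ?exprn_gt0//; last plra.
rewrite subr_ge0 ler_pdivrMr//.
rewrite -(ler_pM2l E_gt0) mulrA [E * D]mulrC.
have K0 : 0 < E ^+ 2 - m ^+ 2 by have := sqr_ge0 D; plra.
rewrite (@le_trans _ _ ((E ^+ 2 - m ^+ 2) * (E ^+ 2 - m ^+ 2 + p * E)))//.
  by rewrite ler_wpM2r// addr_ge0// ?mulr_ge0// ltW.
by rewrite mulrCA ler_pM2l.
Qed.

(** Steps from below [l] go up, so positivity is at stake only above [l]. There it holds if the
    remainder at [l] is nonnegative, since no step then crosses [l] downwards, or if [D] is small,
    by [psi_tangent_neg]. If the remainder at [l] is negative, a start below [l] never gets above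
    it. *)
Lemma psi_newton l (p0 : R) : 0 < l -> psi_fun l = 0 -> 0 <= p0 ->
  p0 <= l \/ D <= (E ^+ 2 - m ^+ 2) / E ->
  [/\ newton_well_defined psi_fun p0,
      forall n, (1 <= n)%N -> 0 < newton psi_fun p0 n
    & quadratic_convergence (newton psi_fun p0) l].
Proof.
move=> l_gt0 psil p0_ge0 hp0; have l0 := ltW l_gt0.
pose r x := psi_rem x l.
pose N x := x - psi_fun x / psi_der x.
have der_gt0 x : 0 <= x -> 0 < psi_der x.
  by move=> x0; exact: lt_le_trans (psi_der_ge x0).
have NE x : 0 <= x -> N x - l = r x * (x - l) ^+ 2 / psi_der x.
  move=> x0; apply: newton_step_dist; first by rewrite gt_eqF ?der_gt0.
  by rewrite -psil; exact: psi_taylor.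
have Nge x : 0 <= x -> 0 <= r x -> l <= N x.
  move=> x0 rx; rewrite -subr_ge0 NE//; apply: divr_ge0; last exact/ltW/der_gt0.
  by apply: mulr_ge0 => //; exact: sqr_ge0.
have Nle x : 0 <= x -> r x <= 0 -> N x <= l.
  move=> x0 rx; rewrite -subr_le0 NE// ler_pdivrMr ?der_gt0// mul0r.
  by rewrite mulr_le0_ge0// sqr_ge0.
have step_up x : 0 <= x -> x <= l -> D * (l - x) / psi_der x <= N x - x.
  move=> x0 xl; rewrite /N addrAC subrr add0r -mulNr.
  rewrite ler_pM2r ?invr_gt0 ?der_gt0//.
  by have := psi_fun_expansive x0 xl; rewrite psil sub0r.
have step_down x : l <= x -> D * (x - l) / psi_der x <= x - N x.
  move=> xl; rewrite /N opprB addrCA subrr addr0.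
  rewrite ler_pM2r ?invr_gt0 ?der_gt0//; last exact: le_trans xl.
  by have := psi_fun_expansive l0 xl; rewrite psil subr0.
(* Only the first alternative depends on [x]. It is preserved when [r l <= 0]; otherwise the second
   one takes over. *)
pose P x := 0 <= x /\ [\/ x <= l, 0 <= r l | D <= (E ^+ 2 - m ^+ 2) / E].
have N_gt0 x : P x -> 0 < N x.
  move=> [x0]; have [xl _|xl] := ltP x l.
    rewrite (le_lt_trans x0)// -subr_gt0; apply: lt_le_trans (step_up x x0 (ltW xl)).
    by rewrite divr_gt0 ?mulr_gt0 ?der_gt0// subr_gt0.
  case=> [lx|rl|DK].
  - have -> : x = l by apply/le_anti; rewrite lx xl.
    by rewrite /N psil mul0r subr0.
  - apply: lt_le_trans (Nge x x0 _) => //.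
    by apply: le_trans rl _; exact: psi_rem_mono.
  - rewrite /N subr_gt0 ltr_pdivrMr ?der_gt0//.
    by apply: psi_tangent_neg => //; exact: lt_le_trans xl.
have rmono_le x : 0 <= x -> x <= l -> r x <= r l by move=> *; exact: psi_rem_mono.
have rmono_ge x : l <= x -> r l <= r x by move=> *; exact: psi_rem_mono.
have [] := @newton_cvg R psi_fun psi_der P l p0
  (((gamma - 1)^-1 + D / (2 * wroot 0) * (E / wroot 0) ^+ 2) / D).
- by move=> x [x0 _]; exact: is_derive_psi.
- by move=> x [x0 _]; rewrite gt_eqF ?der_gt0.
- by split=> //; case: hp0 => ?; [constructor 1|constructor 3].
- move=> x Px; split; first by rewrite ltW// N_gt0.
  have [x0 [xl|rl|DK]] := Px; [|by constructor 2|by constructor 3].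
  have [rl|/ltW rl] := leP 0 (r l); [by constructor 2|constructor 1].
  by apply: Nle => //; apply: le_trans rl; exact: rmono_le.
- have [rl|/ltW rl] := leP 0 (r l); [right|left] => x [x0 _] xl.
    by apply: Nge => //; apply: le_trans rl _; exact: rmono_ge.
  by apply: Nle => //; apply: le_trans rl; exact: rmono_le.
(* Within distance [B] of [l] the derivative is at most [S], while the mean slope of [psi_fun] is at
   least [D]; hence the fraction [D / S]. *)
- move=> B; pose M := l + `|B|.
  pose S := (2 * M + (2 - gamma) * E) / (gamma - 1) + D * E / wroot 0.
  have M0 : 0 <= M by rewrite addr_ge0.
  have DS : D <= S by apply: le_trans (psi_der_ge M0) (psi_der_le M0 (lexx _)).
  have S0 : 0 < S by exact: lt_le_trans DS.
  exists (D / S); first by rewrite divr_gt0//= ler_pdivrMr// mul1r.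
  move=> x [x0 _] xB; have xM : x <= M.
    rewrite -lerBlDl; apply: le_trans (ler_norm _) _; apply: le_trans xB _.
    exact: ler_norm.
  have scale y : 0 <= y -> D / S * y <= D * y / psi_der x.
    move=> y0; rewrite mulrAC ler_wpM2l ?mulr_ge0 ?(ltW D_gt0)//.
    by rewrite lef_pV2 ?posrE ?der_gt0//; exact: psi_der_le.
  by split=> xl; [apply: le_trans (step_up x x0 xl)|
    apply: le_trans (step_down x xl)]; rewrite scale// subr_ge0.
- move=> x [x0 _]; rewrite NE// normrM normfV normrM (ger0_norm (sqr_ge0 _)).
  rewrite real_normK ?num_real// mulrAC ler_wpM2r ?sqr_ge0//.
  rewrite (gtr0_norm (der_gt0 _ x0)) ler_pM ?invr_ge0 ?(ltW (der_gt0 _ x0))//.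
    exact: psi_rem_bound.
  by rewrite lef_pV2 ?posrE ?der_gt0//; exact: psi_der_ge.
move=> wd it quad; split=> // -[//|n] _.
by have [Pn ->] := it n; exact: N_gt0.
Qed.

(** The intermediate value theorem on the interval from 0 to [(gamma - 1) * E]: at 0 the value is
    [wroot 0 * (D - wroot 0) < 0], and at the right end the factor [p / (gamma - 1) - E]
    vanishes. *)
Lemma psi_fun_root : exists2 p, 0 < p & psi_fun p = 0.
Proof.
have w0 : 0 < wroot 0 by exact: wroot_gt0.
have w0E : wroot 0 ^+ 2 = E ^+ 2 - m ^+ 2 by rewrite wroot_sqr// addr0.
have gE : 0 <= (gamma - 1) * E by rewrite mulr_ge0//; plra.
have f0 : psi_fun 0 < 0.
  have -> : psi_fun 0 = wroot 0 * (D - wroot 0).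
    have -> : wroot 0 * (D - wroot 0) = D * wroot 0 - wroot 0 ^+ 2 by ring.
    by rewrite w0E /psi_fun; ring.
  rewrite pmulr_rlt0// subr_lt0 -ltr_sqr ?nnegrE ?(ltW D_gt0) ?(ltW w0)//.
  by rewrite w0E; plra.
have fE : 0 < psi_fun ((gamma - 1) * E).
  rewrite /psi_fun mulrAC divff ?mul1r; last by rewrite gt_eqF//; plra.
  rewrite subrr mulr0 addr0 ltr_wpDl ?sqr_ge0// mulr_gt0//.
  exact: wroot_gt0.
have [||p] := @IVT R psi_fun 0 ((gamma - 1) * E) 0 gE.
- apply: derivable_within_continuous => x; rewrite in_itv/= => /andP[x0 _].
  by case: (is_derive_psi x0).
- by rewrite minEle maxEle (ltW (lt_trans f0 fE)) !ltW.
rewrite in_itv/= => /andP[p0 _] pr; exists p => //.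
rewrite lt_neqAle p0 andbT; apply/eqP => p_0.
by move: pr f0; rewrite -p_0 => ->; rewrite ltxx.
Qed.

End PsiNewton.

(** * The physical pressure as a root of [psi], and the two starting points *)

Section Pressure.
Context {R : realType} {d : nat}.
Implicit Types (gamma p l rho : R) (v : 'rV[R]_d) (U : conserved R d).

Lemma enorm_ge0 v : 0 <= enorm v.
Proof. exact: sqrtr_ge0. Qed.

Lemma enormZ a v : enorm (a *: v) = `|a| * enorm v.
Proof.
rewrite /enorm -sqrtr_sqr -sqrtrM ?sqr_ge0//; congr Num.sqrt.
by rewrite mulr_sumr; apply: eq_bigr => i _; rewrite mxE exprMn.
Qed.

Lemma admissible_bounds U : admissible U ->
  [/\ 0 < dens U, 0 < ener U
    & dens U ^+ 2 + enorm (mom U) ^+ 2 < ener U ^+ 2].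
Proof.
move=> [D0]; rewrite subr_gt0 => hE.
have E0 : 0 < ener U by exact: le_lt_trans (sqrtr_ge0 _) hE.
split=> //; rewrite -[ltLHS]sqr_sqrtr ?addr_ge0 ?sqr_ge0//.
by rewrite ltr_sqr ?nnegrE ?sqrtr_ge0 ?ltW.
Qed.

(** With [Z = E + p] and [c] the inverse Lorentz factor, [psi] factors as [Z * (p / (gamma - 1) + p
    + D * c - Z * c ^+ 2)]. Here [D * c] is [rho] and [Z * c ^+ 2] is [rho] times the enthalpy, so
    the second factor is zero. *)
Lemma primitive_psi gamma U rho v p : 1 < gamma ->
  is_primitive gamma U rho v p -> psi gamma U p = 0.
Proof.
move=> g1 [[rho0 p0 v1] [DE mE EE]].
have g0 : 0 < gamma - 1 by rewrite subr_gt0.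
have n0 := enorm_ge0 v.
have r0 : 0 < 1 - enorm v ^+ 2 by rewrite subr_gt0 expr_lt1.
pose c := Num.sqrt (1 - enorm v ^+ 2).
have c0 : 0 < c by rewrite sqrtr_gt0.
have c2 : enorm v ^+ 2 = 1 - c ^+ 2 by rewrite [c ^+ 2]sqr_sqrtr ?subKr// ltW.
pose Z := dens U * enthalpy gamma rho p * lorentz v.
have Zc : Z * c ^+ 2 = rho + p / (gamma - 1) + p.
  rewrite /Z DE /enthalpy /internal_energy /lorentz -/c; field.
  by rewrite !gt_eqF.
have Z0 : 0 < Z.
  rewrite -(pmulr_lgt0 _ (exprn_gt0 2 c0)) Zc.
  by rewrite !addr_gt0// divr_gt0.
have EZ : ener U + p = Z by rewrite EE subrK.
have Dc : dens U * c = rho by rewrite DE /lorentz -/c mulfVK// gt_eqF.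
rewrite /psi EZ {1}EE -/Z mE enormZ -/Z (gtr0_norm Z0) exprMn.
have -> : Z ^+ 2 - Z ^+ 2 * enorm v ^+ 2 = (Z * c) ^+ 2 by rewrite c2; ring.
rewrite sqrtr_sqr (gtr0_norm (mulr_gt0 Z0 c0)) c2.
have -> : Z ^+ 2 * (1 - c ^+ 2) + Z * (p / (gamma - 1) - (Z - p))
  + dens U * (Z * c) = Z * (p / (gamma - 1) + p + dens U * c - Z * c ^+ 2).
  by ring.
by rewrite Zc Dc; ring.
Qed.

(** The same factorization read backwards: the velocity is [m / (E + p)] and the rest density is [D]
    divided by its Lorentz factor. *)
Lemma psi_primitive gamma U p : 1 < gamma -> admissible U -> 0 < p ->
  psi gamma U p = 0 -> exists rho v, is_primitive gamma U rho v p.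
Proof.
move=> g1 /admissible_bounds[D0 E0 DmE] p0.
have g0 : 0 < gamma - 1 by rewrite subr_gt0.
pose Z := ener U + p; pose v := Z^-1 *: mom U.
have Z0 : 0 < Z by rewrite addr_gt0.
have Zn0 : Z != 0 by rewrite gt_eqF.
have nv : enorm v = enorm (mom U) / Z.
  by rewrite enormZ gtr0_norm ?invr_gt0// mulrC.
have mZ : enorm (mom U) ^+ 2 < Z ^+ 2.
  have := mulr_ge0 (ltW E0) (ltW p0); have := sqr_ge0 p.
  by have := sqr_ge0 (dens U); rewrite /Z; lra.
have n1 : enorm v < 1.
  rewrite nv ltr_pdivrMr// mul1r -ltr_sqr ?nnegrE ?enorm_ge0//.
  exact: ltW.
pose c := Num.sqrt (1 - enorm v ^+ 2).
have r0 : 0 < 1 - enorm v ^+ 2 by rewrite subr_gt0 expr_lt1// enorm_ge0.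
have c0 : 0 < c by rewrite sqrtr_gt0.
have m2 : enorm (mom U) ^+ 2 = Z ^+ 2 * (1 - c ^+ 2).
  by rewrite [c ^+ 2]sqr_sqrtr ?(ltW r0)// nv; field.
rewrite /psi -/Z m2.
have -> : Z ^+ 2 - Z ^+ 2 * (1 - c ^+ 2) = (Z * c) ^+ 2 by ring.
rewrite sqrtr_sqr (gtr0_norm (mulr_gt0 Z0 c0)).
have -> : ener U = Z - p by rewrite /Z addrK.
have -> : Z ^+ 2 * (1 - c ^+ 2) + Z * (p / (gamma - 1) - (Z - p))
  + dens U * (Z * c) = Z * (p / (gamma - 1) + p + dens U * c - Z * c ^+ 2).
  by ring.
move=> /eqP; rewrite mulf_eq0 (negbTE Zn0)/= subr_eq0 => /eqP Zc.
have hZ : dens U * enthalpy gamma (dens U * c) p * lorentz v = Z.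
  have c2 : c ^+ 2 != 0 by rewrite gt_eqF// exprn_gt0.
  apply: (mulIf c2); rewrite -Zc /enthalpy /internal_energy /lorentz -/c; field.
  by rewrite !gt_eqF.
exists (dens U * c), v; split; first by split=> //; rewrite mulr_gt0.
split.
- by rewrite /lorentz -/c mulfK// gt_eqF.
- by rewrite hZ /v scalerA mulfV// scale1r.
- by rewrite hZ /Z addrK.
Qed.

(** A positive root of [psi] yields a primitive triple, so [xget] does not return its default value
    and the pressure belongs to a genuine triple. *)
Lemma pressure_root gamma U : 1 < gamma <= 2 -> admissible U ->
  0 < pressure gamma U /\ psi gamma U (pressure gamma U) = 0.
Proof.
move=> /andP[g1 g2] hU; have [D0 E0 DmE] := admissible_bounds hU.
have [l l0 psil] := psi_fun_root D0 E0 DmE g1 g2.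
have /xgetPex : exists p, [set p | exists rho v, is_primitive gamma U rho v p] p.
  by exists l; exact: psi_primitive.
rewrite -/(pressure gamma U) => /(_ 0)[rho [v pv]].
by split; [case: pv => -[] | exact: primitive_psi pv].
Qed.

(** If [c2 > 0] the curvature at 0 is positive; otherwise the start is the larger root of the
    quadratic [quartic_curv], which is nonnegative because [c2 <= 0 <= c3]. *)
Lemma p0_NR1_spec gamma U : gamma <= 2 -> 0 < ener U ->
  let s := p0_NR1 gamma U in
  [/\ 0 <= s, 0 <= quartic_curv (c2 gamma U) (c3 gamma U) s
    & s = 0 \/ quartic_curv (c2 gamma U) (c3 gamma U) s = 0].
Proof.
move=> g2 E0; rewrite /p0_NR1 /quartic_curv.
have : 0 <= c3 gamma U by rewrite /c3 !mulr_ge0 ?subr_ge0// ltW.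
move: (c2 gamma U) (c3 gamma U) => a b b0.
case: ltP => a0 /=; first by rewrite !(expr0n, mulr0, addr0); split=> //; [exact: ltW|left].
have r0 : 0 <= 9 * b ^+ 2 - 24 * a by have := sqr_ge0 b; lra.
set r := Num.sqrt _; have rE : r ^+ 2 = 9 * b ^+ 2 - 24 * a by exact: sqr_sqrtr.
have rb : 3 * b <= r.
  by rewrite -ler_sqr ?nnegrE ?sqrtr_ge0// ?rE; lra.
have curv0 : a + 3 * b * ((- 3 * b + r) / 12) + 6 * ((- 3 * b + r) / 12) ^+ 2 = 0.
  by lra.
by rewrite curv0; split=> //; [lra|right].
Qed.

(** Up to the factor [(gamma - 1) ^+ 2], [phi] is the product of [psi] and its conjugate, in which
    the sign of the square root is reversed. At [l] the conjugate equals [-2 * D * w], so the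
    derivative of [phi] there is a negative multiple of [psi_der l > 0], as [quartic_newton]
    requires. *)
Lemma phi_newton gamma U l : 1 < gamma <= 2 -> admissible U ->
  0 < l -> psi gamma U l = 0 ->
  [/\ newton_well_defined (phi gamma U) (p0_NR1 gamma U),
      forall n, (1 <= n)%N -> 0 < newton (phi gamma U) (p0_NR1 gamma U) n
    & quadratic_convergence (newton (phi gamma U) (p0_NR1 gamma U)) l].
Proof.
move=> /andP[g1 g2] hU l0 psil; have [D0 E0 DmE] := admissible_bounds hU.
have g0 : gamma - 1 != 0 by rewrite subr_eq0 gt_eqF.
have phiE : phi gamma U =
    quartic (c0 gamma U) (c1 gamma U) (c2 gamma U) (c3 gamma U).
  by apply/funext => p; rewrite phi_expand ?gt_eqF.
have [s0 cs s_infl] := p0_NR1_spec g2 E0.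
have wl := wroot_gt0 D0 E0 DmE (ltW l0).
have wE := wroot_sqr D0 E0 DmE (ltW l0).
have dl := lt_le_trans D0 (psi_der_ge D0 E0 DmE g1 g2 (ltW l0)).
set w := wroot _ _ l in wl wE.
pose A := enorm (mom U) ^+ 2 + (ener U + l) * (l / (gamma - 1) - ener U).
have Aw : A = - (dens U * w) by apply/eqP; rewrite -addr_eq0; apply/eqP.
rewrite phiE; apply: quartic_newton => //.
- by rewrite /c3 !mulr_ge0 ?subr_ge0// ltW.
- by rewrite -phiE /phi -wE -/A Aw; ring.
- have -> : quartic_der (c1 gamma U) (c2 gamma U) (c3 gamma U) l =
    - (2 * (gamma - 1) ^+ 2 * (dens U * w) *
       psi_der (dens U) (enorm (mom U)) (ener U) gamma l).
    have -> : psi_der (dens U) (enorm (mom U)) (ener U) gamma l =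
        (2 * l + (2 - gamma) * ener U) / (gamma - 1)
        + dens U * (ener U + l) / w by [].
    transitivity (2 * (gamma - 1) ^+ 2 *
        (A * ((2 * l + (2 - gamma) * ener U) / (gamma - 1))
         - dens U ^+ 2 * (ener U + l))).
      by rewrite /quartic_der /c1 /c2 /c3 /A; field.
    by rewrite Aw; field; rewrite g0 gt_eqF.
  have gg : 0 < (gamma - 1) ^+ 2 by rewrite exprn_gt0// subr_gt0.
  rewrite oppr_lt0; apply: mulr_gt0 => //; apply: mulr_gt0; last exact: mulr_gt0.
  exact: mulr_gt0.
Qed.

(** For [p_cu >= 0]: with [w = sqrt (E ^+ 2 - m ^+ 2)] the bracket under the root is
    [- w * (w - D) <= 0], so the outer square root is at least [(2 - gamma) * E]. *)
Lemma p0_NR2_spec gamma U : 1 < gamma <= 2 -> admissible U ->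
  0 <= p0_NR2 gamma U /\
  (p0_NR2 gamma U = 0 \/
   dens U <= (ener U ^+ 2 - enorm (mom U) ^+ 2) / ener U).
Proof.
move=> /andP[g1 g2] hU; have [D0 E0 DmE] := admissible_bounds hU.
rewrite /p0_NR2; case: (leP (_ / ener U)) => [_|/ltW ?] /=; first by split=> //; left.
split; last by right.
rewrite /p_cu divr_ge0//.
set E := ener U in E0 DmE *; set D := dens U in D0 DmE *.
set m := enorm _ in DmE *.
have K0 : 0 < E ^+ 2 - m ^+ 2 by have := sqr_ge0 D; lra.
set w := Num.sqrt (E ^+ 2 - m ^+ 2).
have w0 : 0 < w by rewrite sqrtr_gt0.
have wE : w ^+ 2 = E ^+ 2 - m ^+ 2 by rewrite sqr_sqrtr// ltW.
have Dw : D <= w by rewrite -ler_sqr ?nnegrE ?(ltW D0) ?(ltW w0)// wE; lra.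
have gE : 0 <= (2 - gamma) * E by rewrite mulr_ge0 ?(ltW E0)// subr_ge0.
have h : 0 <= 4 * (gamma - 1) * (w * (w - D)).
  by rewrite !mulr_ge0 ?(ltW w0) ?subr_ge0// ltW.
have -> : (gamma - 2) * E = - ((2 - gamma) * E) by ring.
rewrite addrC subr_ge0 -[leLHS]ger0_norm// -sqrtr_sqr; apply: ler_wsqrtr.
have -> : m ^+ 2 - E ^+ 2 = - w ^+ 2 by rewrite wE opprB.
rewrite exprMn -subr_ge0; apply: le_trans h _; rewrite le_eqVlt.
by apply/orP; left; apply/eqP; ring.
Qed.

End Pressure.

Theorem mainTheorem4 (R : realType) (d : nat) (hd : (1 <= d)%N)
    (gamma eps1 eps2 : R) (U : conserved R d)
    (hgamma : 1 < gamma <= 2) (heps1 : 0 < eps1 < 1) (heps2 : 0 < eps2 < 1)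
    (hU : admissible U) :
  [/\ newton_well_defined (hybrid_fun gamma eps1 eps2 U)
        (hybrid_p0 gamma eps1 eps2 U),
      forall n : nat, (1 <= n)%N -> 0 < hybrid_NR gamma eps1 eps2 U n,
      hybrid_NR gamma eps1 eps2 U @ \oo --> pressure gamma U
    & quadratic_convergence (hybrid_NR gamma eps1 eps2 U) (pressure gamma U)].
Proof.
have [l0 psil] := pressure_root hgamma hU.
suff [wd pos quad] : [/\ newton_well_defined (hybrid_fun gamma eps1 eps2 U)
        (hybrid_p0 gamma eps1 eps2 U),
      forall n : nat, (1 <= n)%N -> 0 < hybrid_NR gamma eps1 eps2 U n
    & quadratic_convergence (hybrid_NR gamma eps1 eps2 U) (pressure gamma U)].
  by split=> //; case: quad.
rewrite /hybrid_NR /hybrid_fun /hybrid_p0.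
case: (use_NR1 _ _ _ _); first exact: phi_newton.
have [p0_ge0 hp0] := p0_NR2_spec hgamma hU.
have [D0 E0 DmE] := admissible_bounds hU; have /andP[g1 g2] := hgamma.
apply: (psi_newton D0 E0 DmE g1 g2 l0 psil) => //.
(* A start at 0 lies below the pressure; a start at [p_cu] comes with the bound on [D] that keeps
   the iterates positive. *)
by case: hp0 => [->|]; [left; exact: ltW | right].
Qed.
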